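(* Let $k$ be a field with $u(k)\leq 2$ which is not quadratically closed, with $\mathrm{char}(k)\neq 2$ and $|k|\geq 5$. Let $G:=\mathrm{PSL}_2(k)$. Let $\mathscr{C}_1,\mathscr{C}_2,\mathscr{C}_3$ be three conjugacy classes in $G$, at least two of which are distinct. Then $G\setminus\{1\}\subseteq\mathscr{C}_1\mathscr{C}_2\mathscr{C}_3$.
   Context: A field $k$ has $u(k)\leq 2$ if every quadratic form in $3$ variables over $k$ is isotropic. A field is quadratically closed if it admits no quadratic extension. $\mathrm{PSL}_2(k)=\mathrm{SL}_2(k)/\{\pm I\}$. $\mathscr{C}_1\mathscr{C}_2\mathscr{C}_3=\{xyz: x\in\mathscr{C}_1,y\in\mathscr{C}_2,z\in\mathscr{C}_3\}$.
   Formalization: The three conjugacy classes are required to be nontrivial (different from {1}); with {1} allowed the claim fails, e.g. for C1 = C2 = {1} and C3 any other class whose product C3 is not all of G\{1}. *)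

(* Defs.v *)
From HB Require Import structures.
From mathcomp Require Import all_boot all_order all_algebra all_field.
From mathcomp Require Import boolp classical_sets functions cardinality.

Set Implicit Arguments.
Unset Strict Implicit.
Unset Printing Implicit Defensive.

Import GRing.Theory.
Local Open Scope ring_scope.
Local Open Scope quotient_scope.

(* The quadratic form \sum_(i, j) A i j * x_i * x_j.  The matrix A need not be
   symmetric, so that every homogeneous quadratic polynomial is obtained, in
   every characteristic. *)
Definition quad_form (k : fieldType) (n : nat) (A : 'M[k]_n) (x : 'rV[k]_n) : k :=
  \sum_(i < n) \sum_(j < n) A i j * x 0 i * x 0 j.

Definition isotropic (k : fieldType) (n : nat) (A : 'M[k]_n) : Prop :=
  exists2 x : 'rV[k]_n, x != 0 & quad_form A x = 0.

Definition u_le2 (k : fieldType) : Prop := forall A : 'M[k]_3, isotropic A.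

Definition quadratically_closed (k : fieldType) : Prop :=
  ~ exists L : fieldExtType k, \dim {:L} = 2%N.

Section SL2.
Variable k : fieldType.

Record SL2 := MkSL2 { SL2_mx :> 'M[k]_2; SL2_det : \det SL2_mx == 1 }.

HB.instance Definition _ := [isSub for SL2_mx].
HB.instance Definition _ := [Choice of SL2 by <:].

Lemma SL2_unit (A : SL2) : (A : 'M[k]_2) \in unitmx.
Proof. by rewrite unitmxE (eqP (SL2_det A)) unitr1. Qed.

Fact SL2_one_subproof : \det (1%:M : 'M[k]_2) == 1.
Proof. by rewrite det1. Qed.
Definition SL2_one := MkSL2 SL2_one_subproof.

Fact SL2_mul_subproof (A B : SL2) : \det (A *m B : 'M[k]_2) == 1.
Proof. by rewrite det_mulmx (eqP (SL2_det A)) (eqP (SL2_det B)) mulr1. Qed.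
Definition SL2_mul (A B : SL2) := MkSL2 (SL2_mul_subproof A B).

Fact SL2_inv_subproof (A : SL2) : \det (invmx A : 'M[k]_2) == 1.
Proof. by rewrite det_inv (eqP (SL2_det A)) invr1. Qed.
Definition SL2_inv (A : SL2) := MkSL2 (SL2_inv_subproof A).

Fact SL2_mulA : associative SL2_mul.
Proof. by move=> A B C; apply: val_inj; rewrite /= mulmxA. Qed.
Fact SL2_mul1 : left_id SL2_one SL2_mul.
Proof. by move=> A; apply: val_inj; rewrite /= mul1mx. Qed.
Fact SL2_mulr1 : right_id SL2_one SL2_mul.
Proof. by move=> A; apply: val_inj; rewrite /= mulmx1. Qed.
Fact SL2_mulV : left_inverse SL2_one SL2_inv SL2_mul.
Proof. by move=> A; apply: val_inj; rewrite /= mulVmx ?SL2_unit. Qed.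
Fact SL2_mulrV : right_inverse SL2_one SL2_inv SL2_mul.
Proof. by move=> A; apply: val_inj; rewrite /= mulmxV ?SL2_unit. Qed.

HB.instance Definition _ :=
  isGroup.Build SL2 SL2_mulA SL2_mul1 SL2_mulr1 SL2_mulV SL2_mulrV.

(* A and B have the same image in SL2 / {+-1}. *)
Definition SL2_pm (A B : SL2) : bool :=
  ((A : 'M[k]_2) == B) || ((A : 'M[k]_2) == - (B : 'M[k]_2)).

Lemma SL2_pmP (A B : SL2) :
  reflect ((A : 'M[k]_2) = B \/ (A : 'M[k]_2) = - (B : 'M[k]_2)) (SL2_pm A B).
Proof. by apply: (iffP orP) => -[/eqP|/eqP]; [left|right|left|right]. Qed.

Fact SL2_pm_refl : reflexive SL2_pm.
Proof. by move=> A; rewrite /SL2_pm eqxx. Qed.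
Fact SL2_pm_sym : symmetric SL2_pm.
Proof. by move=> A B; rewrite /SL2_pm eq_sym -eqr_oppLR eq_sym (eq_sym (- _)). Qed.
Fact SL2_pm_trans : transitive SL2_pm.
Proof.
move=> B A C /SL2_pmP AB /SL2_pmP BC; apply/SL2_pmP.
by case: AB => ->; case: BC => ->; rewrite ?opprK; [left|right|right|left].
Qed.

Canonical SL2_pm_equiv := EquivRel SL2_pm SL2_pm_refl SL2_pm_sym SL2_pm_trans.

Definition PSL2 := {eq_quot SL2_pm}.
HB.instance Definition _ := Choice.on PSL2.
HB.instance Definition _ := EqQuotient.on PSL2.

Lemma PSL2_eqP (A B : SL2) :
  reflect ((A : 'M[k]_2) = B \/ (A : 'M[k]_2) = - (B : 'M[k]_2))
          (A == B %[mod PSL2]).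
Proof. by rewrite piE; apply: SL2_pmP. Qed.

Lemma PSL2_repr (A : SL2) :
  (repr (\pi_PSL2 A) : 'M[k]_2) = A \/
  (repr (\pi_PSL2 A) : 'M[k]_2) = - (A : 'M[k]_2).
Proof. by apply/PSL2_eqP; rewrite reprK. Qed.

Definition PSL2_one : PSL2 := lift_cst PSL2 (1%g : SL2).
Definition PSL2_mul := lift_op2 PSL2 (fun A B : SL2 => (A * B)%g).
Definition PSL2_inv := lift_op1 PSL2 (fun A : SL2 => A^-1%g).

Canonical pi_PSL2_one_morph := PiConst PSL2_one.

Lemma pi_PSL2_mul : {morph \pi_PSL2 : A B / (A * B)%g >-> PSL2_mul A B}.
Proof.
unlock PSL2_mul => A B; apply/eqP/PSL2_eqP => /=.
by case: (PSL2_repr A) => ->; case: (PSL2_repr B) => ->;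
   rewrite ?mulNmx ?mulmxN ?opprK; auto.
Qed.
Canonical pi_PSL2_mul_morph := PiMorph2 pi_PSL2_mul.

Lemma pi_PSL2_inv : {morph \pi_PSL2 : A / A^-1%g >-> PSL2_inv A}.
Proof.
unlock PSL2_inv => A; apply/eqP/PSL2_eqP => /=.
have invN : invmx (- (A : 'M[k]_2)) = - invmx A.
  by rewrite -!scaleN1r invmxZ ?unitmxZ ?unitrN1 ?SL2_unit // invrN1.
by case: (PSL2_repr A) => ->; [left | right; rewrite invN opprK].
Qed.
Canonical pi_PSL2_inv_morph := PiMorph1 pi_PSL2_inv.

Fact PSL2_mulA : associative PSL2_mul.
Proof. by elim/quotW=> A; elim/quotW=> B; elim/quotW=> C; rewrite !piE mulgA. Qed.
Fact PSL2_mul1 : left_id PSL2_one PSL2_mul.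
Proof. by elim/quotW=> A; rewrite !piE mul1g. Qed.
Fact PSL2_mulr1 : right_id PSL2_one PSL2_mul.
Proof. by elim/quotW=> A; rewrite !piE mulg1. Qed.
Fact PSL2_mulV : left_inverse PSL2_one PSL2_inv PSL2_mul.
Proof. by elim/quotW=> A; rewrite !piE mulVg. Qed.
Fact PSL2_mulrV : right_inverse PSL2_one PSL2_inv PSL2_mul.
Proof. by elim/quotW=> A; rewrite !piE mulgV. Qed.

HB.instance Definition _ :=
  isGroup.Build PSL2 PSL2_mulA PSL2_mul1 PSL2_mulr1 PSL2_mulV PSL2_mulrV.

End SL2.

Section ConjugacyClasses.
Local Open Scope group_scope.
Local Open Scope classical_set_scope.
Variable G : groupType.

Definition conj_class (x : G) : set G := [set x ^ g | g in [set: G]].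

(* The class {1} is excluded: for C1 = C2 = {1} the product is just C3. *)
Definition nontrivial_conj_class (C : set G) : Prop :=
  exists2 x : G, x <> 1 & C = conj_class x.

Definition prod3 (C1 C2 C3 : set G) : set G :=
  [set g | exists x y z : G, [/\ C1 x, C2 y, C3 z & g = x * y * z]].

End ConjugacyClasses.

(* Main.v *)
(** In SL2, a trace t <> 2, -2 determines the conjugacy class, because over a
    field with u <= 2 every nondegenerate binary quadratic form is universal; a
    class of trace 2 other than {1} contains a transvection [[1, c], [0, 1]].
    Writing g in C1 C2 C3 as x y z w = 1 with w conjugate to g^-1, it suffices
    to find t <> 2, -2 which is the trace of some x y and, up to sign, of some
    z w.  Two classes that are not both unipotent give as products all traces
    but at most one, and those of the transvections c and d give all traces
    2 - c d r^2 with r <> 0.  A count, and the universality of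
    c d X^2 + c' d' Y^2 in the purely unipotent case, provide a common trace. *)

Require Import Defs.
From HB Require Import structures.
From mathcomp Require Import all_boot all_order all_algebra all_field.
From mathcomp Require Import boolp classical_sets functions cardinality.
From mathcomp Require Import ring.

Set Implicit Arguments.
Unset Strict Implicit.
Unset Printing Implicit Defensive.

Import GRing.Theory.
Local Open Scope ring_scope.
Local Open Scope quotient_scope.

(** * Universality of nondegenerate binary quadratic forms *)

Section BinaryForms.
Variable k : fieldType.
Hypothesis k_u : u_le2 k.

(** The ternary form [p X^2 + q X Y + r Y^2 - e W^2] has a nontrivial zero. If its last coordinate
    is nonzero, scaling it to 1 gives the value [e]; otherwise the binary form itself is isotropic,
    and a nondegenerate isotropic binary form takes every value. *)
Lemma binary_form_universal (p q r e : k) :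
  q ^+ 2 - 4 * p * r != 0 ->
  exists x y : k, p * x ^+ 2 + q * x * y + r * y ^+ 2 = e.
Proof.
move=> disc.
pose M : 'M[k]_3 := \matrix_(i, j)
  nth 0 (nth [::] [:: [:: p; q; 0]; [:: 0; r; 0]; [:: 0; 0; - e]] i) j.
have [v v0 Mv] := k_u M.
set x := v 0 0; set y := v 0 1; set w := v 0 2%:R.
have {Mv} xyw : p * x ^+ 2 + q * x * y + r * y ^+ 2 = e * w ^+ 2.
  move: Mv; rewrite /quad_form !big_ord_recl !big_ord0 !mxE /=.
  have -> : v 0 (lift ord0 ord0) = y by congr (v _ _); apply/val_inj.
  have -> : v 0 (lift ord0 (lift ord0 ord0)) = w by congr (v _ _); apply/val_inj.
  rewrite -/x => /eqP Mv; apply/eqP; rewrite -subr_eq0 -(eqP Mv); apply/eqP; ring.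
have [w0|w0] := eqVneq w 0; last first.
  exists (x / w), (y / w); apply: (mulIf (expf_neq0 2 w0)); rewrite -xyw; field.
  by rewrite w0.
move: xyw; rewrite w0 expr0n mulr0 => xy.
(* This is the polar form of [(x, y)] and [(1, 0)]. On the line [l (x, y) + (1, 0)] the quadratic
   term in [l] vanishes, so the form is affine in [l], with this slope. The next case uses [(0, 1)]
   in the same way. *)
have [B1|B1] := eqVneq (2 * p * x + q * y) 0; last first.
  exists ((e - p) / (2 * p * x + q * y) * x + 1).
  exists ((e - p) / (2 * p * x + q * y) * y).
  set l := _ / _.
  transitivity (l ^+ 2 * (p * x ^+ 2 + q * x * y + r * y ^+ 2)
                + l * (2 * p * x + q * y) + p); first ring.
  by rewrite xy mulr0 add0r /l divfK // subrK.
have [B2|B2] := eqVneq (q * x + 2 * r * y) 0; last first.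
  exists ((e - r) / (q * x + 2 * r * y) * x).
  exists ((e - r) / (q * x + 2 * r * y) * y + 1).
  set l := _ / _.
  transitivity (l ^+ 2 * (p * x ^+ 2 + q * x * y + r * y ^+ 2)
                + l * (q * x + 2 * r * y) + r); first ring.
  by rewrite xy mulr0 add0r /l divfK // subrK.
(* Now [(x, y)] is in the radical of the polar form, whose determinant is the discriminant up to
   sign, so all of [v] vanishes. *)
have x0 : x = 0.
  apply: (mulfI disc); rewrite mulr0.
  transitivity (q * (q * x + 2 * r * y) - 2 * r * (2 * p * x + q * y)); first ring.
  by rewrite B1 B2; ring.
have y0 : y = 0.
  apply: (mulfI disc); rewrite mulr0.
  transitivity (q * (2 * p * x + q * y) - 2 * p * (q * x + 2 * r * y)); first ring.
  by rewrite B1 B2; ring.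
case/eqP: v0; apply/rowP=> i; rewrite mxE.
case: i => [[|[|[|//]]] lti]; [rewrite -x0|rewrite -y0|rewrite -w0];
  by congr (v _ _); apply/val_inj.
Qed.

End BinaryForms.

(** * Values of quadratic forms at suitable field elements *)

Section FieldElements.
Variable k : fieldType.
Hypothesis k_char : (2 : k) != 0.
Hypothesis k_card : forall s : seq k, (size s <= 4)%N -> exists x, x \notin s.


Lemma exists_sqr_neq (a d : k) :
  a != 0 -> exists2 t : k, t != 0 & a * t ^+ 2 != d.
Proof.
move=> a0.
have [[t0 at0]|nt0] := pselect (exists t0, a * t0 ^+ 2 = d); last first.
  by exists 1; [exact: oner_neq0|apply/eqP=> a1; apply: nt0; exists 1].
have [t] := k_card (s := [:: 0; t0; - t0]) isT.
rewrite !inE !negb_or => /and3P[t_0 tt0 tt0'].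
exists t => //; apply/eqP; rewrite -at0 => /(mulfI a0)/eqP.
by rewrite eqf_sqr (negPf tt0) (negPf tt0').
Qed.

(** Counting falls short here: 0 and the roots of [a t^2 = 2] and [a t^2 = 4] may be five elements,
    while [k_card] avoids only four. If both equations have roots [u] and [v], a suitable [t] is
    built from these roots. *)
Lemma exists_sqr_neq24 (a : k) :
  a != 0 -> exists t : k, [/\ t != 0, a * t ^+ 2 != 2 & a * t ^+ 2 != 4].
Proof.
move=> a0.
have [[u au]|nu] := pselect (exists u, a * u ^+ 2 = 2); last first.
  have [t t0 at4] := exists_sqr_neq 4 a0.
  by exists t; split=> //; apply/eqP=> at2; apply: nu; exists t.
have u0 : u != 0.
  by apply/eqP=> u0; move: au k_char; rewrite u0 expr0n mulr0 => <-; rewrite eqxx.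
have [[v av]|nv] := pselect (exists v, a * v ^+ 2 = 4); last first.
  have [t t0 at2] := exists_sqr_neq 2 a0.
  by exists t; split=> //; apply/eqP=> at4; apply: nv; exists t.
have [c3|c3] := eqVneq (3 : k) 0; last first.
  have E : a * (2 * u) ^+ 2 = 8.
    by transitivity (4 * (a * u ^+ 2)); [ring|rewrite au; ring].
  exists (2 * u); rewrite E; split; first by rewrite mulf_neq0.
    apply: contra_neq (mulf_neq0 k_char c3) => e.
    by transitivity (8 - 2 : k); [ring|rewrite e subrr].
  apply: contra_neq (mulf_neq0 k_char k_char) => e.
  by transitivity (8 - 4 : k); [ring|rewrite e subrr].
(* In characteristic 3, [m] is a square root of [8 = -1], and [t = u + v] gives
   [a t^2 = 6 + 2 m = 2 m]. The values to avoid would force [m] to be 0, 1 or 2, whose squares are 0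
   or 1. *)
set m := a * u * v.
have m2 : m ^+ 2 = -1.
  transitivity ((a * u ^+ 2) * (a * v ^+ 2)); first by rewrite /m; ring.
  rewrite au av; transitivity (3 * 3 - 1 : k); [ring|rewrite c3; ring].
have mN1 (e : k) : e ^+ 2 = 1 -> m <> e.
  move=> e2 me; move/eqP: k_char; apply.
  by transitivity (1 - (-1) : k); [ring|rewrite -m2 me e2 subrr].
have E : a * (u + v) ^+ 2 = 2 * m.
  transitivity (a * u ^+ 2 + a * v ^+ 2 + 2 * m); first by rewrite /m; ring.
  rewrite au av; transitivity (2 * 3 + 2 * m); [ring|rewrite c3; ring].
exists (u + v); rewrite E; split.
- apply/eqP=> uv; move/eqP: E; rewrite uv expr0n mulr0 eq_sym mulf_eq0 (negPf k_char).
  by move=> /eqP m0; move/eqP: m2; rewrite m0 expr0n eq_sym oppr_eq0 oner_eq0.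
- by rewrite -[X in _ != X]mulr1; apply/eqP=> /(mulfI k_char)/mN1; apply; ring.
- have -> : (4 : k) = 2 * 2 by ring.
  apply/eqP=> /(mulfI k_char)/mN1; apply.
  by transitivity (3 + 1 : k); [ring|rewrite c3 add0r].
Qed.

(** The conic [a X^2 + b Y^2 = 4] has a point by universality. A point on a coordinate axis is
    replaced by another one from the rational parametrization of the conic. *)
Lemma exists_diag_form_eq4 (a b : k) : u_le2 k -> a != 0 -> b != 0 ->
  (forall m : k, b <> a * m ^+ 2) ->
  exists r s : k, [/\ r != 0, s != 0 & a * r ^+ 2 + b * s ^+ 2 = 4].
Proof.
move=> k_u.
(* Reduction to a point [(x, 0)]; the other axis follows by exchanging [a] and [b]. *)
wlog suff: a b / a != 0 -> b != 0 -> (forall m : k, b <> a * m ^+ 2) ->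
    forall x, a * x ^+ 2 = 4 ->
  exists r s : k, [/\ r != 0, s != 0 & a * r ^+ 2 + b * s ^+ 2 = 4].
  move=> H a0 b0 ab.
  have [|x [y]] := binary_form_universal k_u 4 (p := a) (q := 0) (r := b).
    have -> : 0 ^+ 2 - 4 * a * b = - (2 * 2 * a * b) by ring.
    by rewrite oppr_eq0 !mulf_neq0.
  rewrite mul0r mul0r addr0 => xy.
  have [y0|y0] := eqVneq y 0.
    by apply: (H _ _ a0 b0 ab x); rewrite -xy y0; ring.
  have [x0|x0] := eqVneq x 0; last by exists x, y.
  have [||r [s [r0 s0 rs]]] := H b a b0 a0 _ y.
  - move=> m abm; have m0 : m != 0.
      by apply: contra_neq a0 => m0; rewrite abm m0 expr0n mulr0.
    apply: (ab m^-1); rewrite abm; field; exact: m0.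
  - by rewrite -xy x0; ring.
  by exists s, r; split=> //; rewrite addrC.
move=> a0 b0 ab x ax.
have x0 : x != 0.
  apply: contra_neq (mulf_neq0 k_char k_char) => x0.
  by transitivity (4 : k); [ring|rewrite -ax x0 expr0n mulr0].
(* The parameter [t] must keep the denominator [a + b t^2] nonzero; the numerator [a - b t^2] is
   nonzero because [b / a] is not a square. *)
have [t t0 bt] := exists_sqr_neq (- a) b0.
have dt : a + b * t ^+ 2 != 0 by rewrite addrC -(opprK a) subr_eq0.
exists (x * (a - b * t ^+ 2) / (a + b * t ^+ 2)), (x * (2 * a * t) / (a + b * t ^+ 2)).
split.
- rewrite !mulf_neq0 ?invr_eq0 // subr_eq0; apply/eqP=> abt.
  by apply: (ab t^-1); rewrite abt; field.
- by rewrite !mulf_neq0 ?invr_eq0.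
- by rewrite -ax; field.
Qed.

(** If [b / a] is a square, both sides represent the same values. Otherwise [a r^2 + b s^2 = 4] says
    exactly that the two traces are opposite, and [s != 0] gives [a r^2 != 4]. *)
Lemma exists_common_trace (a b : k) : u_le2 k -> a != 0 -> b != 0 ->
  exists r s : k, [/\ r != 0, s != 0, a * r ^+ 2 != 4 &
    2 - a * r ^+ 2 = 2 - b * s ^+ 2 \/ 2 - a * r ^+ 2 = - (2 - b * s ^+ 2)].
Proof.
move=> k_u a0 b0.
have [[m bam]|nm] := pselect (exists m, b = a * m ^+ 2).
  have m0 : m != 0 by apply: contra_neq b0 => m0; rewrite bam m0 expr0n mulr0.
  have [r r0 ar] := exists_sqr_neq 4 a0.
  exists r, (r / m); split=> //; first by rewrite mulf_neq0 ?invr_eq0.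
  by left; rewrite bam; field.
have [m bam|r [s [r0 s0 rs]]] := exists_diag_form_eq4 k_u a0 b0.
  by apply: nm; exists m.
exists r, s; split=> //.
  rewrite -rs -subr_eq0 opprD addrA subrr sub0r oppr_eq0.
  by rewrite mulf_neq0 ?expf_neq0.
right; apply/eqP; rewrite -subr_eq0; apply/eqP.
by transitivity (4 - (a * r ^+ 2 + b * s ^+ 2)); [ring|rewrite rs subrr].
Qed.

End FieldElements.

(** * Conjugacy as a relation in a group *)

Definition conjugate (G : groupType) (x y : G) := exists g : G, y = (x ^ g)%g.

Lemma conjugate_refl (G : groupType) (x : G) : conjugate x x.
Proof. by exists 1%g; rewrite conjg1. Qed.

Lemma conjugate_sym (G : groupType) (x y : G) : conjugate x y -> conjugate y x.
Proof. by case=> g ->; exists g^-1%g; rewrite conjgK. Qed.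

Lemma conjugate_trans (G : groupType) (y x z : G) :
  conjugate x y -> conjugate y z -> conjugate x z.
Proof. by case=> g -> [h ->]; exists (g * h)%g; rewrite conjgM. Qed.

(** * Explicit two by two matrices in SL2 *)

Section SL2Classes.
Variable k : fieldType.

Definition mx2 (a b c d : k) : 'M[k]_2 :=
  \matrix_(i, j) (if i == 0 then if j == 0 then a else b
                  else if j == 0 then c else d).

Lemma mx2_eta (A : 'M[k]_2) : A = mx2 (A 0 0) (A 0 1) (A 1 0) (A 1 1).
Proof.
apply/matrixP=> i j; rewrite mxE.
by case: (unliftP 0 i) => [i'|] ->; rewrite ?(ord1 i');
   case: (unliftP 0 j) => [j'|] ->; rewrite ?(ord1 j') //=;
   congr (A _ _); apply/val_inj.
Qed.

Lemma mulmx2 (a b c d a' b' c' d' : k) :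
  mx2 a b c d *m mx2 a' b' c' d' =
  mx2 (a * a' + b * c') (a * b' + b * d') (c * a' + d * c') (c * b' + d * d').
Proof.
rewrite [LHS]mx2_eta; congr mx2;
  by rewrite !mxE !big_ord_recl big_ord0 !mxE /= addr0.
Qed.

Lemma det_mx2 (a b c d : k) : \det (mx2 a b c d) = a * d - b * c.
Proof.
rewrite (expand_det_row _ 0) !big_ord_recl big_ord0 /cofactor !det_mx11 !mxE /=.
by rewrite expr0 expr1; ring.
Qed.

Lemma det_mx22 (A : 'M[k]_2) : \det A = A 0 0 * A 1 1 - A 0 1 * A 1 0.
Proof. by rewrite {1}[A]mx2_eta det_mx2. Qed.

Lemma mxtrace_mx2 (a b c d : k) : \tr (mx2 a b c d) = a + d.
Proof. by rewrite /mxtrace !big_ord_recl big_ord0 !mxE /= addr0. Qed.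

Lemma oppmx2 (a b c d : k) : - mx2 a b c d = mx2 (- a) (- b) (- c) (- d).
Proof. by rewrite [LHS]mx2_eta !mxE. Qed.

Fact det_mx2_1 (a b c d : k) :
  a * d - b * c = 1 -> \det (mx2 a b c d) == 1.
Proof. by rewrite det_mx2 => ->. Qed.

Definition sl2 (a b c d : k) (h : a * d - b * c = 1) : SL2 k :=
  MkSL2 (det_mx2_1 h).

Fact transvection_subproof (c : k) : 1 * 1 - c * 0 = 1.
Proof. by rewrite mulr0 subr0 mulr1. Qed.
Definition transvection (c : k) : SL2 k := sl2 (transvection_subproof c).

Lemma SL2_mxM (A B : SL2 k) : (A * B)%g = (A : 'M[k]_2) *m B :> 'M[k]_2.
Proof. by []. Qed.

Lemma conjugate_SL2 (A B g : SL2 k) :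
  (A : 'M[k]_2) *m g = (g : 'M[k]_2) *m B -> conjugate A B.
Proof.
move=> AgB; exists g.
have : (A * g)%g = (g * B)%g by apply/val_inj.
by rewrite conjgE => ->; rewrite mulKg.
Qed.

Lemma tr_conjugate (A B : SL2 k) :
  conjugate A B -> \tr (A : 'M[k]_2) = \tr (B : 'M[k]_2).
Proof.
case=> g ->; rewrite conjgE !SL2_mxM mxtrace_mulC.
have -> : (A : 'M[k]_2) *m g *m (g^-1)%g = (A * g * g^-1)%g by [].
by rewrite mulgK.
Qed.

Lemma SL2_entries (A : SL2 k) :
  exists a b c d (h : a * d - b * c = 1), A = sl2 h.
Proof.
have h : A 0 0 * A 1 1 - A 0 1 * A 1 0 = 1.
  by rewrite -det_mx22; apply/eqP/SL2_det.
by exists (A 0 0), (A 0 1), (A 1 0), (A 1 1), h; apply/val_inj/mx2_eta.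
Qed.

Lemma tr_SL2_inv (A : SL2 k) : \tr ((A^-1)%g : 'M[k]_2) = \tr (A : 'M[k]_2).
Proof.
have [a [b [c [d [h ->]]]]] := SL2_entries A.
have h' : d * a - (- b) * (- c) = 1 by rewrite -h; ring.
have -> : (sl2 h)^-1%g = sl2 h'.
  apply: (mulgI (sl2 h)); rewrite mulgV; apply/val_inj; rewrite /= mulmx2.
  rewrite [LHS]mx2_eta !mxE /=; congr mx2; rewrite -?h; ring.
by rewrite /= !mxtrace_mx2 addrC.
Qed.

(** * Normal forms of conjugacy classes in SL2 *)

Hypothesis k_u : u_le2 k.

Definition semisimple_trace (t : k) : bool := (t != 2) && (t != - 2).

Lemma semisimple_disc (t : k) : semisimple_trace t = (t ^+ 2 - 4 != 0).
Proof.
have -> : t ^+ 2 - 4 = (t - 2) * (t + 2) by ring.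
by rewrite mulf_eq0 negb_or subr_eq0 addr_eq0.
Qed.

Fact companion_subproof (t : k) : 0 * t - (-1) * 1 = 1.
Proof. by ring. Qed.
Definition companion (t : k) : SL2 k := sl2 (companion_subproof t).

(* A matrix with columns v, A v conjugates A to its companion matrix;
   its determinant is a quadratic form in v, of discriminant (tr A)^2 - 4. *)
Lemma conjugate_companion (A : SL2 k) :
  semisimple_trace (\tr (A : 'M[k]_2)) ->
  conjugate A (companion (\tr (A : 'M[k]_2))).
Proof.
have [a [b [c [d [h ->]]]]] := SL2_entries A.
rewrite /= mxtrace_mx2 semisimple_disc => disc.
have [|x [y xy]] := binary_form_universal k_u 1 (p := c) (q := d - a) (r := - b).
  have -> // : (d - a) ^+ 2 - 4 * c * - b = (a + d) ^+ 2 - 4.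
  by transitivity ((a + d) ^+ 2 - 4 * (a * d - b * c)); [ring|rewrite h; ring].
have gh : x * (c * x + d * y) - (a * x + b * y) * y = 1 by rewrite -xy; ring.
apply: (conjugate_SL2 (g := sl2 gh)); rewrite /= !mulmx2.
congr mx2; try ring.
- transitivity ((a + d) * (a * x + b * y) - x * (a * d - b * c)); first ring.
  by rewrite h; ring.
- transitivity ((a + d) * (c * x + d * y) - y * (a * d - b * c)); first ring.
  by rewrite h; ring.
Qed.

Lemma conjugate_semisimple (A B : SL2 k) :
  semisimple_trace (\tr (A : 'M[k]_2)) ->
  \tr (A : 'M[k]_2) = \tr (B : 'M[k]_2) -> conjugate A B.
Proof.
move=> ssA AB; apply: conjugate_trans (conjugate_companion ssA) _.
by apply: conjugate_sym; rewrite AB; apply: conjugate_companion; rewrite -AB.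
Qed.

Lemma conjugate_transvection (A : SL2 k) :
  \tr (A : 'M[k]_2) = 2 -> A <> 1%g ->
  exists2 c, c != 0 & conjugate A (transvection c).
Proof.
have [a [b [c [d [h ->]]]]] := SL2_entries A.
rewrite /= mxtrace_mx2 => ad A1.
have {ad} dE : d = 2 - a by rewrite -ad; ring.
have N : (a - 1) ^+ 2 = - (b * c).
  by transitivity (1 - a * d); [|rewrite -h]; rewrite ?dE; ring.
have [c0|c0] := eqVneq c 0.
  have a1 : a = 1 by apply/eqP; rewrite -subr_eq0 -sqrf_eq0 N c0 mulr0 oppr0.
  have AE : sl2 h = transvection b.
    apply/val_inj; rewrite /= dE c0 a1; congr mx2; ring.
  exists b; last by rewrite AE; apply: conjugate_refl.
  apply/eqP=> b0; apply: A1; rewrite AE b0; apply/val_inj.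
  by rewrite /= [RHS]mx2_eta !mxE.
exists (- c); first by rewrite oppr_eq0.
(* The first column [((a - 1) / c, 1)] is fixed by the matrix; the second, [(-1, 0)], completes it
   to determinant 1 and is moved by [-c] times the first. *)
have gh : (a - 1) / c * 0 - (-1) * 1 = 1 by ring.
apply: (conjugate_SL2 (g := sl2 gh)); rewrite /= !mulmx2.
congr mx2; [| by field | by rewrite dE; field | ring].
transitivity (((a - 1) ^+ 2 + b * c) / c + (a - 1) / c); first by field.
by rewrite N; field.
Qed.

(** * Traces of products of two conjugacy classes in SL2 *)

Definition product_trace (A B : SL2 k) (t : k) :=
  exists A' B', [/\ conjugate A A', conjugate B B' &
                    \tr (A' *m B' : 'M[k]_2) = t].

Lemma product_traceC (A B : SL2 k) (t : k) :
  product_trace A B t -> product_trace B A t.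
Proof.
by case=> A' [B' [cA cB trAB]]; exists B', A'; split=> //; rewrite mxtrace_mulC.
Qed.

Lemma product_trace_conjugate (A A' B B' : SL2 k) (t : k) :
  conjugate A A' -> conjugate B B' -> product_trace A' B' t -> product_trace A B t.
Proof.
move=> cA cB [A'' [B'' [cA' cB' tE]]]; exists A'', B''.
by split=> //; [apply: conjugate_trans cA'|apply: conjugate_trans cB'].
Qed.

(* The matrices B of trace b and determinant 1 with tr (A B) = t, A a companion
   matrix, form an affine conic whose leading form is nondegenerate: translated
   to its centre (x0, z0), its equation is that this form takes a given value. *)
Lemma product_trace_semisimple (A B : SL2 k) (t : k) :
  semisimple_trace (\tr (A : 'M[k]_2)) -> semisimple_trace (\tr (B : 'M[k]_2)) ->
  product_trace A B t.
Proof.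
set a := \tr (A : 'M[k]_2); set b := \tr (B : 'M[k]_2) => ssA ssB.
have D : a ^+ 2 - 4 != 0 by rewrite -semisimple_disc.
pose m := t - a * b.
pose x0 := - (2 * b + a * m) / (a ^+ 2 - 4).
pose z0 := (a * b + 2 * m) / (a ^+ 2 - 4).
have [|x [z xz]] := binary_form_universal k_u
   (x0 ^+ 2 + a * x0 * z0 + z0 ^+ 2 - 1) (p := 1) (q := a) (r := 1).
  by rewrite !mulr1.
have gh : (x + x0) * (b - (x + x0)) - ((z + z0) + m + a * (x + x0)) * (z + z0) = 1.
  transitivity (x0 ^+ 2 + a * x0 * z0 + z0 ^+ 2
     - (1 * x ^+ 2 + a * x * z + 1 * z ^+ 2)); last by rewrite xz; ring.
  by rewrite /x0 /z0; field.
exists (companion a), (sl2 gh); split.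
- exact: conjugate_companion.
- by apply: conjugate_semisimple => //=; rewrite mxtrace_mx2 -/b; ring.
- by rewrite /= mulmx2 mxtrace_mx2 /m; ring.
Qed.

(** Multiplying by the transvection adds to the trace [c] times the lower left entry, which must
    therefore be [(t - b) / c]. As it is nonzero, the upper right entry can be solved for
    determinant 1 with diagonal [0, b]. *)
Lemma product_trace_mixed (c t : k) (B : SL2 k) :
  c != 0 -> semisimple_trace (\tr (B : 'M[k]_2)) -> t != \tr (B : 'M[k]_2) ->
  product_trace (transvection c) B t.
Proof.
set b := \tr _ => c0 ssB; rewrite -subr_eq0 => tb.
have gh : 0 * b - (- (c / (t - b))) * ((t - b) / c) = 1 by field; rewrite c0.
exists (transvection c), (sl2 gh); split.
- exact: conjugate_refl.
- by apply: conjugate_semisimple => //=; rewrite mxtrace_mx2 -/b; ring.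
- by rewrite /= mulmx2 mxtrace_mx2; field; rewrite -/b tb.
Qed.

(** The transvection of [d] is conjugate to the lower unitriangular matrix with entry [- d r^2], by
    an antidiagonal matrix with entries [- r^-1] and [r]. *)
Lemma product_trace_transvections (c d r : k) :
  r != 0 -> product_trace (transvection c) (transvection d) (2 - c * d * r ^+ 2).
Proof.
move=> r0.
have gh : 0 * 0 - (- r^-1) * r = 1 by field.
have dh : 1 * 1 - 0 * (- (d * r ^+ 2)) = 1 by ring.
exists (transvection c), (sl2 dh); split.
- exact: conjugate_refl.
- apply/conjugate_sym/(conjugate_SL2 (g := sl2 gh)); rewrite /= !mulmx2.
  by congr mx2; field.
- by rewrite /= mulmx2 mxtrace_mx2; ring.
Qed.

(** Trace [-2] is left out because a lift from PSL2 may be replaced by its opposite. *)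
Definition PSL2_regular (A : SL2 k) :=
  semisimple_trace (\tr (A : 'M[k]_2)) \/
  exists2 c, c != 0 & conjugate A (transvection c).

Definition mixed_traces (A B : SL2 k) :=
  exists b, forall t, t != b -> product_trace A B t.

Definition unipotent_traces (A B : SL2 k) :=
  exists2 a, a != 0 & forall r, r != 0 -> product_trace A B (2 - a * r ^+ 2).

Lemma regular_product_traces (A B : SL2 k) : PSL2_regular A -> PSL2_regular B ->
  mixed_traces A B \/ unipotent_traces A B.
Proof.
move=> [ssA|[c c0 cA]] [ssB|[d d0 dB]].
(* Every trace occurs here, so the exceptional value 0 is arbitrary. *)
- by left; exists 0 => t _; apply: product_trace_semisimple.
- left; exists (\tr (A : 'M[k]_2)) => t tA; apply: product_traceC.
  exact: product_trace_conjugate dB (conjugate_refl _) (product_trace_mixed d0 ssA tA).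
- left; exists (\tr (B : 'M[k]_2)) => t tB.
  exact: product_trace_conjugate cA (conjugate_refl _) (product_trace_mixed c0 ssB tB).
- right; exists (c * d); first by rewrite mulf_neq0.
  move=> r r0; apply: (product_trace_conjugate cA dB).
  exact: product_trace_transvections.
Qed.

(** * Traces common to two pairs of classes *)

Hypothesis k_char : (2 : k) != 0.
Hypothesis k_card : forall s : seq k, (size s <= 4)%N -> exists x, x \notin s.

(** The sign is free for the second pair since only images in PSL2 matter. *)
Definition joint_trace (A B C D : SL2 k) (t : k) :=
  [/\ semisimple_trace t, product_trace A B t &
      product_trace C D t \/ product_trace C D (- t)].

Lemma joint_trace_sym (A B C D : SL2 k) (t : k) :
  joint_trace C D A B t -> exists t', joint_trace A B C D t'.
Proof.
case=> st tCD [tAB|tAB]; first by exists t; split; auto.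
exists (- t); split=> //; last by right; rewrite opprK.
by move: st; rewrite !semisimple_disc sqrrN.
Qed.

Lemma semisimple_2B (x : k) : x != 0 -> x != 4 -> semisimple_trace (2 - x).
Proof.
move=> x0 x4; rewrite /semisimple_trace -subr_eq0 addrAC subrr sub0r oppr_eq0 x0 /=.
rewrite -subr_eq0; have -> : 2 - x - - 2 = 4 - x by ring.
by rewrite subr_eq0 eq_sym.
Qed.

Lemma neq_or_oppr_neq (t b : k) : t != 0 -> t != b \/ - t != b.
Proof.
move=> t0; have [tb|] := eqVneq t b; last by left.
right; rewrite -tb -subr_eq0 -opprD oppr_eq0.
by rewrite -mulr2n -mulr_natl mulf_neq0.
Qed.

(** For [t = 2 - a r^2], the conditions [r != 0] and [a r^2 != 4] make [t] semisimple, and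
    [a r^2 != 2] makes it nonzero, so that [t] or [-t] avoids the exceptional trace [b]. *)
Lemma joint_trace_mixed_unipotent (A B C D : SL2 k) :
  mixed_traces A B -> unipotent_traces C D -> exists t, joint_trace C D A B t.
Proof.
move=> [b tAB] [a a0 tCD]; have [r [r0 r2 r4]] := exists_sqr_neq24 k_char k_card a0.
exists (2 - a * r ^+ 2); split.
- by apply: semisimple_2B; rewrite // mulf_neq0 ?expf_neq0.
- exact: tCD.
have := @neq_or_oppr_neq (2 - a * r ^+ 2) b; rewrite subr_eq0 eq_sym r2.
by case=> // ?; [left|right]; apply: tAB.
Qed.

Lemma exists_joint_trace (A B C D : SL2 k) :
  PSL2_regular A -> PSL2_regular B -> PSL2_regular C -> PSL2_regular D ->
  exists t, joint_trace A B C D t.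
Proof.
move=> rA rB rC rD.
have [mAB|uAB] := regular_product_traces rA rB;
  have [mCD|uCD] := regular_product_traces rC rD.
- have [[b tAB] [b' tCD]] := (mAB, mCD).
  (* Excluding 0 makes [t] and [-t] distinct, so one of them avoids [b']. *)
  have [t] := k_card (s := [:: 0; 2; -2; b]) isT.
  rewrite !inE !negb_or => /and4P[t0 t2 tN2 tb].
  exists t; split; [by apply/andP|exact: tAB|].
  by case: (neq_or_oppr_neq b' t0) => ?; [left|right]; apply: tCD.
- have [t tP] := joint_trace_mixed_unipotent mAB uCD.
  exact: joint_trace_sym tP.
- exact: joint_trace_mixed_unipotent mCD uAB.
- have [[a a0 tAB] [b b0 tCD]] := (uAB, uCD).
  have [r [s [r0 s0 r4 rs]]] := exists_common_trace k_char k_card k_u a0 b0.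
  exists (2 - a * r ^+ 2); split.
  + by apply: semisimple_2B; rewrite // mulf_neq0 ?expf_neq0.
  + exact: tAB.
  + by case: rs => rs; [left|right]; rewrite rs ?opprK; apply: tCD.
Qed.

(** * Passage from SL2 to PSL2 *)

(* The type annotation lets the group structure of PSL2 k be inferred. *)
Definition PSL2_pi (A : SL2 k) : PSL2 k := \pi A.

Lemma pi_PSL2M (A B : SL2 k) : PSL2_pi (A * B)%g = (PSL2_pi A * PSL2_pi B)%g.
Proof. exact: pi_PSL2_mul. Qed.

Lemma pi_PSL2V (A : SL2 k) : PSL2_pi (A^-1)%g = (PSL2_pi A)^-1%g.
Proof. exact: pi_PSL2_inv. Qed.

Lemma pi_PSL21 : PSL2_pi (1%g : SL2 k) = 1%g.
Proof. by rewrite -[RHS]/(PSL2_one k) piE. Qed.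

Lemma pi_conjg (A g : SL2 k) : PSL2_pi (A ^ g)%g = (PSL2_pi A ^ PSL2_pi g)%g.
Proof. by rewrite !conjgE !pi_PSL2M pi_PSL2V. Qed.

Lemma pi_conjugate (A B : SL2 k) :
  conjugate A B -> conjugate (PSL2_pi A) (PSL2_pi B).
Proof. by case=> g ->; exists (PSL2_pi g); rewrite pi_conjg. Qed.

Lemma pi_opp (A B : SL2 k) :
  (A : 'M[k]_2) = - (B : 'M[k]_2) -> PSL2_pi A = PSL2_pi B.
Proof. by move=> AB; apply/eqP/PSL2_eqP; right. Qed.

Lemma SL2_opp (A : SL2 k) : exists A' : SL2 k, (A' : 'M[k]_2) = - (A : 'M[k]_2).
Proof.
have [a [b [c [d [h ->]]]]] := SL2_entries A.
have h' : (- a) * (- d) - (- b) * (- c) = 1 by rewrite -h; ring.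
by exists (sl2 h'); rewrite /= oppmx2.
Qed.

Lemma PSL2_lift_regular (X : PSL2 k) :
  X <> 1%g -> exists2 A : SL2 k, PSL2_regular A & X = PSL2_pi A.
Proof.
elim/quotW: X => A; rewrite -/(PSL2_pi A) => A1.
have [ssA|] := boolP (semisimple_trace (\tr (A : 'M[k]_2))).
  by exists A; [left|].
rewrite negb_and !negbK => /orP[] /eqP trA.
  exists A => //; right; apply: conjugate_transvection => // AE.
  by apply: A1; rewrite AE pi_PSL21.
have [A' A'E] := SL2_opp A.
have AA' := pi_opp A'E.
exists A'; last by rewrite AA'.
right; apply: conjugate_transvection => [|AE]; first by rewrite A'E raddfN /= trA opprK.
by apply: A1; rewrite -AA' AE pi_PSL21.
Qed.

(** After a change of sign [E] of [C' D'], the matrices [A' B'] and [E^-1] share the semisimple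
    trace [t], hence are conjugate by some [g]. Conjugating [C'] and [D'] by [g] then makes their
    product inverse to [A' B'] in PSL2. *)
Lemma joint_trace_PSL2 (A B C D : SL2 k) (t : k) : joint_trace A B C D t ->
  exists x y z w : PSL2 k,
    [/\ conjugate (PSL2_pi A) x, conjugate (PSL2_pi B) y, conjugate (PSL2_pi C) z,
        conjugate (PSL2_pi D) w & (x * y * (z * w) = 1)%g].
Proof.
case=> st [A' [B' [cA cB tAB]]] tCD.
have [C' [D' [cC cD tCD']]] : exists C' D', [/\ conjugate C C', conjugate D D' &
    \tr (C' *m D' : 'M[k]_2) = t \/ \tr (C' *m D' : 'M[k]_2) = - t].
  by case: tCD => -[C' [D' [cC cD tE]]]; exists C', D'; split; auto.
have [E piE trE] : exists2 E : SL2 k,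
    PSL2_pi E = PSL2_pi (C' * D')%g & \tr (E : 'M[k]_2) = t.
  case: tCD' => tE; first by exists (C' * D')%g.
  have [E EE] := SL2_opp (C' * D')%g; exists E; first exact: pi_opp.
  by rewrite EE raddfN /= tE opprK.
have [g Eg] : conjugate (E^-1)%g (A' * B')%g.
  by apply: conjugate_semisimple; rewrite tr_SL2_inv trE.
exists (PSL2_pi A'), (PSL2_pi B'), (PSL2_pi (C' ^ g)%g), (PSL2_pi (D' ^ g)%g).
split; try by apply: pi_conjugate => //.
- by apply: pi_conjugate; apply: conjugate_trans cC _; exists g.
- by apply: pi_conjugate; apply: conjugate_trans cD _; exists g.
rewrite -!pi_PSL2M Eg -conjMg pi_PSL2M !pi_conjg -piE -conjMg -pi_PSL2M.
by rewrite mulVg pi_PSL21 conj1g.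
Qed.

End SL2Classes.

(** * The cardinality hypothesis and the conclusion in PSL2 *)

Lemma card_ge5_notin (T : choiceType) :
  ([set: 'I_5]%classic #<= [set: T]%classic)%card ->
  forall s : seq T, (size s <= 4)%N -> exists x, x \notin s.
Proof.
case/card_leP=> f s s4; apply: contrapT => ns.
pose h (i : 'I_5) : T := val (f (to_setT i)).
have h_inj : injective h by move=> i j /val_inj e; have /(congr1 val) := injT e.
have hs : {subset [seq h i | i : 'I_5] <= s}.
  by move=> x _; apply/negPn/negP=> xs; apply: ns; exists x.
have : (size [seq h i | i : 'I_5] <= size s)%N.
  by apply: uniq_leq_size hs; rewrite map_inj_uniq ?enum_uniq.
by rewrite size_map size_enum_ord leqNgt ltnS s4.
Qed.

Theorem theorem1p5 (k : fieldType)
    (k_u : u_le2 k)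
    (k_nqc : ~ quadratically_closed k)
    (k_char : 2%N \notin [pchar k]%R)
    (k_card : ([set: 'I_5]%classic #<= [set: k]%classic)%card)
    (C1 C2 C3 : set (PSL2 k))
    (C1_class : nontrivial_conj_class C1)
    (C2_class : nontrivial_conj_class C2)
    (C3_class : nontrivial_conj_class C3)
    (C_distinct : C1 <> C2 \/ C1 <> C3 \/ C2 <> C3) :
  (~` [set 1%g : PSL2 k] `<=` prod3 C1 C2 C3)%classic.
Proof.
have k2 : (2 : k) != 0 by move: k_char; rewrite inE.
have k5 := card_ge5_notin k_card.
case: C1_class C2_class C3_class => [X1 X1n ->] [X2 X2n ->] [X3 X3n ->] g gn.
have [A1 rA1 E1] := PSL2_lift_regular X1n.
have [A2 rA2 E2] := PSL2_lift_regular X2n.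
have [A3 rA3 E3] := PSL2_lift_regular X3n.
have gVn : (g^-1)%g <> 1%g.
  by move=> gV1; apply: gn; rewrite /= -[g]invgK gV1 invg1.
have [A4 rA4 E4] := PSL2_lift_regular gVn.
have [t] := exists_joint_trace k_u k2 k5 rA1 rA2 rA3 rA4.
case/(joint_trace_PSL2 k_u); rewrite -E1 -E2 -E3 -E4.
move=> _ [_ [_ [_ [[x ->] [y ->] [z ->] [w ->] e]]]].
(* Conjugating the relation [e] by [w^-1] turns its last factor into [g^-1], so the other three
   factors multiply to [g]. *)
exists (X1 ^ (x * w^-1))%g, (X2 ^ (y * w^-1))%g, (X3 ^ (z * w^-1))%g.
split; [by exists (x * w^-1)%g|by exists (y * w^-1)%g|by exists (z * w^-1)%g|].
rewrite !conjgM -!conjMg; apply: (conjg_inj w); rewrite conjgKV.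
by apply: (mulIg (g^-1 ^ w)%g); rewrite -conjMg mulgV conj1g -mulgA e.
Qed.
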